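(* Let $N \ge 2$ and let $0 \le m < N$ be integers. Then there is no interruptible exact stationary sampling algorithm in the passive setting using $m$ independent trajectories for irreducible aperiodic Markov chains on $N$ states. That is, there is no collection of functions $\phi_{k,i}$ ($k \ge 0$, $i \in [N]$) satisfying properties (i), (ii), (iii) and (iv$'$) of the context.
   Context: Write $[N] = \{1,\dots,N\}$. An interruptible exact stationary sampling algorithm in the passive setting, using $m$ independent trajectories, for irreducible aperiodic Markov chains on $[N]$, is a collection of functions $\phi_{k,i}: ([N]^m)^{k+1} \to [0,1]$, $k \ge 0$, $i\in[N]$, where $\phi_{k,i}(x(0),\dots,x(k))$, with $x(t) = (x_1(t),\dots,x_m(t)) \in [N]^m$, is interpreted as the conditional probability that the algorithm stops by time $k$ and outputs $i$, given that the $m$ observed trajectories through time $k$ are $(x_l(0),\dots,x_l(k))$, $1\le l\le m$. The functions do not depend on the transition matrix or the initial distribution. For a probability distribution $\rho$ on $[N]^m$ and a transition matrix $\mathbf{P}=(p_{ij})$ on $[N]$, put $$a_{k,i}(\rho,\mathbf{P}) := \sum_{x(0),\dots,x(k)\in[N]^m} \rho(x(0)) \left[\prod_{l=1}^m \prod_{t=1}^k p_{x_l(t-1),x_l(t)}\right] \phi_{k,i}(x(0),\dots,x(k)).$$ The required properties are: (i) for all $k\ge 0$ and all $(x(0),\dots,x(k))$: $\sum_{j\in[N]} \phi_{k,j}(x(0),\dots,x(k)) \le 1$; (ii) for all $i\in[N]$ and all infinite sequences $(x(0),x(1),\dots)$ in $[N]^m$, $\phi_{k,i}(x(0),\dots,x(k))$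 is nondecreasing in $k$; and, for every irreducible aperiodic transition matrix $\mathbf{P}$ on $[N]$ with (unique) stationary distribution $\pi$, and every probability distribution $\rho$ on $[N]^m$: (iii) $\lim_{k\to\infty} \sum_{j\in[N]} a_{k,j}(\rho,\mathbf{P}) > 0$ (the algorithm stops with positive probability); (iv$'$) for all $i\in[N]$ and all $k\ge 0$: $a_{k,i}(\rho,\mathbf{P}) = \pi_i \sum_{j\in[N]} a_{k,j}(\rho,\mathbf{P})$ (the output is distributed as $\pi$, independently of the stopping time). *)

(* Defs.v *)
From mathcomp Require Import all_boot all_order all_algebra.
From mathcomp Require Import all_classical all_reals all_analysis.

Set Implicit Arguments.
Unset Strict Implicit.
Unset Printing Implicit Defensive.

Import Order.TTheory GRing.Theory Num.Theory.
Import numFieldNormedType.Exports.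

Local Open Scope classical_set_scope.
Local Open Scope ring_scope.

Definition is_distribution (R : realType) (T : finType) (rho : T -> R) : Prop :=
  (forall x, 0 <= rho x) /\ \sum_x rho x = 1.

Definition is_transition (R : realType) (N : nat) (P : 'M[R]_N) : Prop :=
  forall i, is_distribution (P i).

Definition irreducible (R : realType) (N : nat) (P : 'M[R]_N) : Prop :=
  forall i j, exists n, 0 < (P ^+ n) i j.

(* d is the gcd of the set of return times {n >= 1 | (P ^+ n) i i > 0}. *)
Definition is_period (R : realType) (N : nat) (P : 'M[R]_N) (i : 'I_N)
    (d : nat) : Prop :=
  let return_time n := (0 < n)%N /\ 0 < (P ^+ n) i i in
  (forall n, return_time n -> (d %| n)%N) /\
  (forall e, (forall n, return_time n -> (e %| n)%N) -> (e %| d)%N).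

Definition aperiodic (R : realType) (N : nat) (P : 'M[R]_N) : Prop :=
  forall i, is_period P i 1.

Definition is_stationary (R : realType) (N : nat) (P : 'M[R]_N)
    (p : 'rV[R]_N) : Prop :=
  is_distribution (p 0) /\ p *m P = p.

(* [N]^m; the states 1, ..., N are represented by 0, ..., N - 1. *)
Definition config (N m : nat) := {ffun 'I_m -> 'I_N}.

(* ([N]^m)^(k+1): the m trajectories observed at times 0, ..., k. *)
Definition history (N m k : nat) := {ffun 'I_k.+1 -> config N m}.

Definition prefix_history (N m : nat) (y : nat -> config N m) (k : nat) :
    history N m k :=
  [ffun t : 'I_k.+1 => y t].

Definition rules (R : realType) (N m : nat) :=
  forall k : nat, 'I_N -> history N m k -> R.

(* The index t : 'I_k stands for the step from time t to time t + 1: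
   widen_ord (leqnSn k) t has value t and lift ord0 t has value t + 1. *)
Definition stop_output_prob (R : realType) (N m : nat) (phi : rules R N m)
    (rho : config N m -> R) (P : 'M[R]_N) (k : nat) (i : 'I_N) : R :=
  \sum_(x : history N m k)
    rho (x ord0) *
    (\prod_(l < m) \prod_(t < k)
       P (x (widen_ord (leqnSn k) t) l) (x (lift ord0 t) l)) *
    phi k i x.

(* In sampler_stops the sequence is nondecreasing and bounded by
   sampler_mono and sampler_sum_le1, so limn is a genuine limit. *)
Record interruptible_exact_sampler (R : realType) (N m : nat)
    (phi : rules R N m) : Prop := {
  sampler_range : forall k i (x : history N m k), 0 <= phi k i x <= 1;
  sampler_sum_le1 : forall k (x : history N m k), \sum_j phi k j x <= 1;
  sampler_mono : forall i (y : nat -> config N m) k k', (k <= k')%N ->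
    phi k i (prefix_history y k) <= phi k' i (prefix_history y k');
  sampler_stops : forall (P : 'M[R]_N) (rho : config N m -> R),
    is_transition P -> irreducible P -> aperiodic P -> is_distribution rho ->
    0 < limn (fun k => \sum_j stop_output_prob phi rho P k j);
  sampler_exact : forall (P : 'M[R]_N) (p : 'rV[R]_N) (rho : config N m -> R),
    is_transition P -> irreducible P -> aperiodic P -> is_stationary P p ->
    is_distribution rho ->
    forall i k, stop_output_prob phi rho P k i =
      p 0 i * \sum_j stop_output_prob phi rho P k j }.

(* Main.v *)
Require Import Defs.
From mathcomp Require Import all_boot all_order all_algebra.
From mathcomp Require Import all_classical all_reals all_analysis.
From mathcomp Require Import ring lra zify.

(** A sampler must already fail on the lazy cyclic chains, where state [v]
    moves to its cyclic successor [ordS v] with probability [x v] and otherwise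
    stays put. Such a chain has stationary weights proportional to [(x v)^-1]
    ([cyclic_chain_stationary]), so exactness says that, for a fixed time [k]
    and a fixed initial configuration, [x i * a_i] does not depend on [i],
    where [a_i] is the probability of having output [i] by time [k]
    ([slow_output_balance]).

    Let the [x v] tend to 0. A history in which every step stays or advances to
    the successor, and in which state [v] is jumped out of [c v] times, has
    probability [\prod_v x v ^+ c v] to leading order; since the stopping rule
    is nonnegative, nothing cancels in [a_i]. To compare monomials with a single
    parameter [eps], put [x v = eps ^+ b ^ v], with the base [b] larger than any
    exponent that can occur: the order in [eps] then encodes the exponents as
    digits in base [b]. The orders of vanishing of the [x i * a_i] agree
    ([lighter_contribution]), hence so do their digits ([digits_inj]): there is
    one vector [n] such that, for every [i], some history that can lead to
    output [i] has jump counts [n] minus the unit vector at [i].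

    Flow conservation finishes the proof. In the history for output [j], at most
    as many jumps leave [ordS j] as enter it from [j], plus the number
    [s (ordS j)] of trajectories that start at [ordS j] ([jump_count_flow]). The
    unit vector lowers only the count at [j], so
    [n (ordS j) + 1 <= n j + s (ordS j)]. Summing over [j] around the cycle
    cancels [n] and leaves [N <= m]. *)

Set Implicit Arguments.
Unset Strict Implicit.
Unset Printing Implicit Defensive.

Import Order.TTheory GRing.Theory Num.Theory.

Local Open Scope ring_scope.

(** * Lazy cyclic chains *)

Definition cyclic_chain (R : realType) (N : nat) (x : 'I_N -> R) : 'M[R]_N :=
  \matrix_(a, b) if b == ordS a then x a else if b == a then 1 - x a else 0.

Lemma ordS_neq (N : nat) (a : 'I_N) : (1 < N)%N -> ordS a != a.
Proof.
move=> N_gt1; apply/negP => /eqP /(congr1 val) /= /eqP.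
rewrite -[X in _ == X](modn_small (ltn_ord a)) -addn1 -[X in _ == X %[mod _]]addn0.
by rewrite eqn_modDl !modn_small // ltnW.
Qed.

Lemma iter_ordS (N n : nat) (a : 'I_N) :
  iter n (@ordS N) a = ((a + n) %% N)%N :> nat.
Proof.
elim: n => [|n IHn] /=; first by rewrite addn0 modn_small.
by rewrite IHn -addn1 modnDml addn1 addnS.
Qed.

Section CyclicChain.
Variables (R : realType) (N : nat) (x : 'I_N -> R).
Hypotheses (N_gt1 : (1 < N)%N) (x_gt0 : forall a, 0 < x a)
  (x_lt1 : forall a, x a < 1).
Local Notation P := (cyclic_chain x).

Lemma cyclic_chain_next a : P a (ordS a) = x a.
Proof. by rewrite mxE eqxx. Qed.

Lemma cyclic_chain_stay a : P a a = 1 - x a.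
Proof. by rewrite mxE eq_sym (negbTE (ordS_neq a N_gt1)) eqxx. Qed.

Lemma cyclic_chain_other a b : b != a -> b != ordS a -> P a b = 0.
Proof. by move=> ba bSa; rewrite mxE (negbTE ba) (negbTE bSa). Qed.

Lemma cyclic_chain_ge0 a b : 0 <= P a b.
Proof.
rewrite mxE; case: eqP => _; first exact: ltW.
by case: eqP => _ //; rewrite subr_ge0 ltW.
Qed.

Lemma cyclic_chain_transition : is_transition P.
Proof.
move=> a; split=> [b|]; first exact: cyclic_chain_ge0.
rewrite (bigD1 a) //= (bigD1 (ordS a)) ?ordS_neq //= big1 => [|b /andP[ba bSa]].
  by rewrite cyclic_chain_next cyclic_chain_stay addr0 subrK.
exact: cyclic_chain_other.
Qed.

Lemma cyclic_chain_pow_ge0 n a b : 0 <= (P ^+ n) a b.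
Proof.
elim: n b => [|n IHn] b; first by rewrite expr0 mxE ler0n.
rewrite exprSr mxE; apply: sumr_ge0 => c _.
by rewrite mulr_ge0 ?cyclic_chain_ge0.
Qed.

Lemma cyclic_chain_pow_gt0 n a : 0 < (P ^+ n) a (iter n (@ordS N) a).
Proof.
elim: n => [|n IHn]; first by rewrite expr0 mxE eqxx ltr01.
rewrite exprSr mxE (bigD1 (iter n (@ordS N) a)) //=.
apply: ltr_wpDr.
  by apply: sumr_ge0 => c _; rewrite mulr_ge0 ?cyclic_chain_pow_ge0 ?cyclic_chain_ge0.
by rewrite cyclic_chain_next mulr_gt0.
Qed.

Lemma cyclic_chain_irreducible : irreducible P.
Proof.
move=> a b; exists (b + (N - a))%N.
have {2}-> : b = iter (b + (N - a))%N (@ordS N) a.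
  apply: val_inj; rewrite /= iter_ordS addnCA subnKC; last exact: ltnW.
  by rewrite modnDr modn_small.
exact: cyclic_chain_pow_gt0.
Qed.

Lemma cyclic_chain_aperiodic : aperiodic P.
Proof.
move=> a; split=> [n _|e]; first exact: dvd1n.
by apply; split=> //; rewrite expr1 cyclic_chain_stay subr_gt0.
Qed.

(** The stationary flow across each edge of the cycle is the same, so a state
    is visited in inverse proportion to its jump probability. *)
Lemma cyclic_chain_stationary :
  is_stationary P (\row_a ((x a)^-1 / \sum_b (x b)^-1)).
Proof.
set Z := \sum_b _.
have a0 : 'I_N by case: N N_gt1 => // n _; exact: ord0.
have Z_gt0 : 0 < Z.
  rewrite /Z (bigD1 a0) //= ltr_wpDr ?invr_gt0 //.
  by apply: sumr_ge0 => b _; rewrite invr_ge0 ltW.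
split.
  split=> [a|]; first by rewrite mxE divr_ge0 ?invr_ge0 ?(ltW (x_gt0 _)) ?ltW.
  under eq_bigr do rewrite mxE.
  by rewrite -mulr_suml divff // gt_eqF.
apply/rowP => b; rewrite !mxE.
(* Only [b] itself and its cyclic predecessor carry mass into [b]. *)
have pb : ord_pred b != b.
  by apply/eqP => e; have := ordS_neq b N_gt1; rewrite -{1}e ord_predK eqxx.
rewrite (bigD1 b) //= (bigD1 (ord_pred b)) //= big1; last first.
  move=> a /andP[ab apb]; rewrite cyclic_chain_other ?mulr0 1?eq_sym //.
  by apply: contra apb => /eqP <-; rewrite ordSK.
have := cyclic_chain_next (ord_pred b); rewrite ord_predK => ->.
rewrite cyclic_chain_stay !mxE addr0.
rewrite mulrBr mulr1 mulrAC mulVf ?gt_eqF // mulrAC mulVf ?gt_eqF //.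
by rewrite subrK.
Qed.

End CyclicChain.

(** * Jump counts of a bundle of trajectories *)

Section JumpCounts.
Variables (N m k : nat) (h : history N m k).

Definition step_source (l : 'I_m) (t : 'I_k) : 'I_N :=
  h (widen_ord (leqnSn k) t) l.

Definition step_target (l : 'I_m) (t : 'I_k) : 'I_N := h (lift ord0 t) l.

Definition jump (l : 'I_m) (t : 'I_k) : bool :=
  step_target l t != step_source l t.

Definition cyclic_history : bool :=
  [forall l, forall t, jump l t ==> (step_target l t == ordS (step_source l t))].

Definition jump_count (v : 'I_N) : nat :=
  \sum_(l < m) \sum_(t < k) (jump l t && (step_source l t == v)).

Definition start_count (v : 'I_N) : nat := \sum_(l < m) (h ord0 l == v).

Lemma jump_count_le v : (jump_count v <= m * k)%N.
Proof.
apply: (@leq_trans (\sum_(l < m) \sum_(t < k) 1)).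
  by do 2!apply: leq_sum => ? _; exact: leq_b1.
by rewrite !sum_nat_const !card_ord muln1.
Qed.

Lemma sum_start_count : \sum_v start_count v = m.
Proof.
rewrite exchange_big /= -[RHS]card_ord -sum1_card; apply: eq_bigr => l _.
rewrite (bigD1 (h ord0 l)) //= eqxx big1 // => v.
by rewrite eq_sym => /negbTE ->.
Qed.

(** The left side is the exponent that arises from multiplying transition
    probabilities step by step, the right side the one that is read off in
    digits. *)
Lemma sum_jump_weight (w : 'I_N -> nat) :
  (\sum_(l < m) \sum_(t < k) (if jump l t then w (step_source l t) else 0) =
   \sum_v jump_count v * w v)%N.
Proof.
under [RHS]eq_bigr do rewrite big_distrl.
rewrite [RHS]exchange_big; apply: eq_bigr => l _ /=.
under [RHS]eq_bigr do rewrite big_distrl.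
rewrite [RHS]exchange_big; apply: eq_bigr => t _ /=.
case: (jump l t) => /=; last by rewrite big1.
rewrite (bigD1 (step_source l t)) //= eqxx mul1n big1 ?addn0 // => v.
by rewrite eq_sym => /negbTE ->.
Qed.

End JumpCounts.

(** Conservation of flow along one trajectory: [ordS v] is entered only by
    jumps out of [v], so jumps out of it match jumps out of [v] up to the two
    ends of the path. *)
Lemma cyclic_path_flow (N : nat) (s : nat -> 'I_N) (v : 'I_N) k :
    (forall t, (t < k)%N -> s t.+1 != s t -> s t.+1 = ordS (s t)) ->
  (\sum_(t < k) ((s t.+1 != s t) && (s t == ordS v)) + (s k == ordS v) =
   \sum_(t < k) ((s t.+1 != s t) && (s t == v)) + (s 0 == ordS v))%N.
Proof.
elim: k => [|k IHk] s_cyclic; first by rewrite !big_ord0.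
have {}IHk := IHk (fun t lt_tk => s_cyclic t (ltnW lt_tk)).
rewrite !big_ord_recr /=; have := s_cyclic k (leqnn _).
case: eqVneq => [-> _ /=|_ /(_ isT) -> /=]; first by rewrite !addn0.
by rewrite (inj_eq (@ordS_inj N)) IHk addnAC.
Qed.

Lemma jump_count_flow (N m k : nat) (h : history N m k) (v : 'I_N) :
  cyclic_history h ->
  (jump_count h (ordS v) <= jump_count h v + start_count h (ordS v))%N.
Proof.
move=> /forallP h_cyclic.
rewrite /jump_count /start_count -big_split; apply: leq_sum => l _ /=.
pose s t := h (inord t) l.
have src t : step_source h l t = s t.
  by congr (h _ l); apply: val_inj; rewrite /= inordK // ltnS ltnW.
have tgt (t : 'I_k) : step_target h l t = s t.+1.
  by congr (h _ l); apply: val_inj; rewrite /= inordK // ltnS.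
have -> : h ord0 l = s 0%N.
  by congr (h _ l); apply: val_inj; rewrite /= inordK.
have flow : forall t, (t < k)%N -> s t.+1 != s t -> s t.+1 = ordS (s t).
  move=> t lt_tk; have /forallP/(_ (Ordinal lt_tk)) := h_cyclic l.
  by rewrite /jump src tgt /= => /implyP jumpS /jumpS /eqP.
rewrite /jump; under eq_bigr do rewrite src tgt.
under [X in (_ <= X + _)%N]eq_bigr do rewrite src tgt.
by rewrite -(cyclic_path_flow v flow) leq_addr.
Qed.

(** Uniqueness of the base-[b] expansion: one weight records all the exponents
    of a monomial. *)
Lemma digits_inj (N b : nat) (c d : 'I_N -> nat) :
    (forall v, c v < b)%N -> (forall v, d v < b)%N ->
  \sum_v (c v * b ^ v)%N = \sum_v (d v * b ^ v)%N -> c =1 d.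
Proof.
elim: N c d => [|N IHN] c d c_lt d_lt; first by move=> _ [].
have shift (e : 'I_N.+1 -> nat) :
    (\sum_v e v * b ^ v = (\sum_(v < N) e (lift ord0 v) * b ^ v) * b + e ord0)%N.
  rewrite big_ord_recl expn0 muln1 addnC; congr (_ + _)%N.
  by rewrite big_distrl; apply: eq_bigr => v _; rewrite /= expnSr mulnA.
rewrite !shift => eq_cd.
have b_gt0 : (0 < b)%N by exact: leq_ltn_trans (c_lt ord0).
have eq0 : c ord0 = d ord0.
  have /(congr1 (modn^~ b)) := eq_cd.
  by rewrite /= !modnMDl !modn_small.
have eqS : (fun v => c (lift ord0 v)) =1 (fun v => d (lift ord0 v)).
  apply: IHN => // ; move: eq_cd; rewrite eq0 => /addIn /eqP.
  by rewrite eqn_pmul2r // => /eqP.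
by move=> v; case: (unliftP ord0 v) => [u ->|->]; [exact: eqS|].
Qed.

(** * Leading orders of the output probabilities *)

Definition path_prob (R : realType) (N m k : nat) (P : 'M[R]_N)
    (h : history N m k) : R :=
  \prod_(l < m) \prod_(t < k) P (step_source h l t) (step_target h l t).

Definition path_weight (N m k : nat) (w : 'I_N -> nat) (h : history N m k) :=
  (\sum_v jump_count h v * w v)%N.

(** Jump probabilities tend to 0 with [eps], at rates set by [w]. *)
Definition slow_chain (R : realType) (N : nat) (w : 'I_N -> nat) (eps : R) :=
  cyclic_chain (fun a => eps ^+ w a).

Section PathBounds.
Variables (R : realType) (N m k : nat) (w : 'I_N -> nat) (eps : R).
Hypotheses (N_gt1 : (1 < N)%N) (w_gt0 : forall a, (0 < w a)%N).
Hypotheses (eps_gt0 : 0 < eps) (eps_le : eps <= 2^-1).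
Local Notation P := (slow_chain w eps).

Let eps_lt1 : eps < 1.
Proof. by apply: le_lt_trans eps_le _; rewrite invf_lt1 ?ltr1n. Qed.

Lemma slow_jump_gt0 a : 0 < eps ^+ w a.
Proof. exact: exprn_gt0. Qed.

Lemma slow_jump_lt1 a : eps ^+ w a < 1.
Proof. by rewrite exprn_ilt1 ?ltW // -lt0n. Qed.

Lemma slow_step_bounds a b : (b != a) ==> (b == ordS a) ->
  2^-1 * eps ^+ (if b != a then w a else 0) <= P a b
    <= eps ^+ (if b != a then w a else 0).
Proof.
case: eqVneq => [-> _|_ /eqP -> /=].
  rewrite /slow_chain cyclic_chain_stay //= expr0.
  have : eps ^+ w a <= eps by rewrite -{2}[eps]expr1 ler_wiXn2l // ltW.
  by move: (slow_jump_gt0 a) eps_le => ? ? ?; apply/andP; split; lra.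
by rewrite /slow_chain cyclic_chain_next lexx andbT ler_piMl ?ltW ?slow_jump_gt0 ?invf_lt1 ?ltr1n.
Qed.

Lemma path_prob_noncyclic (h : history N m k) :
  ~~ cyclic_history h -> path_prob P h = 0.
Proof.
move=> /forallPn[l /forallPn[t]]; rewrite negb_imply => /andP[jump_lt not_next].
apply/eqP/prodf_eq0; exists l => //; apply/prodf_eq0; exists t => //.
by apply/eqP/cyclic_chain_other.
Qed.

(** Staying put has probability between 1/2 and 1, so [path_prob] is of order
    exactly [eps ^+ path_weight w h]; there are [m * k] steps. *)
Lemma path_prob_bounds (h : history N m k) : cyclic_history h ->
  2^-1 ^+ (m * k) * eps ^+ path_weight w h <= path_prob P h
    <= eps ^+ path_weight w h.
Proof.
move=> /forallP h_cyclic.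
have step l t := slow_step_bounds (forallP (h_cyclic l) t).
have -> : eps ^+ path_weight w h = \prod_(l < m) \prod_(t < k)
    eps ^+ (if jump h l t then w (step_source h l t) else 0).
  rewrite /path_weight -sum_jump_weight -prodrXr.
  by apply: eq_bigr => l _; rewrite -prodrXr.
have -> : 2^-1 ^+ (m * k) = \prod_(l < m) \prod_(t < k) 2^-1 :> R.
  by rewrite !prodr_const !card_ord -exprM mulnC.
rewrite -big_split; under [X in X <= _]eq_bigr do rewrite -big_split.
have half_ge0 : 0 <= 2^-1 :> R by rewrite invr_ge0.
apply/andP; split; apply: ler_prod => l _; apply/andP; split.
- apply: prodr_ge0 => t _; exact: mulr_ge0 half_ge0 (exprn_ge0 _ (ltW eps_gt0)).
- apply: ler_prod => t _; have /andP[lb _] := step l t.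
  by rewrite lb mulr_ge0 // exprn_ge0 // ltW.
- apply: prodr_ge0 => t _; have /andP[lb _] := step l t.
  by apply: le_trans lb; rewrite mulr_ge0 // exprn_ge0 // ltW.
- apply: ler_prod => t _; have /andP[lb ->] := step l t.
  by rewrite andbT; apply: le_trans lb; rewrite mulr_ge0 // exprn_ge0 // ltW.
Qed.

Lemma path_prob_ge0 (h : history N m k) : 0 <= path_prob P h.
Proof.
have [h_cyclic|/path_prob_noncyclic -> //] := boolP (cyclic_history h).
have /andP[lb _] := path_prob_bounds h_cyclic.
by apply: le_trans lb; rewrite mulr_ge0 // exprn_ge0 ?invr_ge0 // ltW.
Qed.

End PathBounds.

Definition point_mass (R : realType) (N m : nat) (x0 : config N m) :
  config N m -> R := fun x => (x == x0)%:R.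

Lemma point_mass_distribution (R : realType) (N m : nat) (x0 : config N m) :
  is_distribution (point_mass R x0).
Proof.
split=> [x|]; first exact: ler0n.
by rewrite (bigD1 x0) //= /point_mass eqxx big1 ?addr0 // => x /negbTE ->.
Qed.

Section LeadingOrder.
Variables (R : realType) (N m k : nat) (phi : rules R N m) (x0 : config N m).
Variable w : 'I_N -> nat.
Hypotheses (N_gt1 : (1 < N)%N) (w_gt0 : forall a, (0 < w a)%N).
Hypothesis phi_sampler : interruptible_exact_sampler phi.
Local Notation prob P i := (stop_output_prob phi (point_mass R x0) P k i).

(** These are the histories with a nonzero term in the probability of output
    [i], whichever cyclic chain is sampled from the initial configuration
    [x0]. *)
Definition contributes (i : 'I_N) (h : history N m k) : bool :=
  [&& h ord0 == x0, cyclic_history h & 0 < phi i h].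

(** The order in [eps] of the term of [h] in the balanced quantity
    [eps ^+ w i * prob _ i]; the summand [w i] is the factor inverse to the
    stationary weight of [i]. *)
Definition output_weight (i : 'I_N) (h : history N m k) : nat :=
  (path_weight w h + w i)%N.

Lemma stop_output_probE (P : 'M[R]_N) i : prob P i =
  \sum_(h : history N m k) (h ord0 == x0)%:R * path_prob P h * phi i h.
Proof. by []. Qed.

Lemma term_noncontributing eps i (h : history N m k) : ~~ contributes i h ->
  (h ord0 == x0)%:R * path_prob (slow_chain w eps) h * phi i h = 0.
Proof.
have /andP[phi_ge0 _] := sampler_range phi_sampler i h.
rewrite !negb_and => /or3P[/negbTE ->|/path_prob_noncyclic ->|].
- by rewrite !mul0r.
- by rewrite mulr0 mul0r.
- by rewrite lt_neqAle phi_ge0 andbT negbK => /eqP <-; rewrite mulr0.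
Qed.

(** Exactness, with the common factor of the stationary law cleared. *)
Lemma slow_output_balance eps i j : 0 < eps -> eps <= 2^-1 ->
  eps ^+ w i * prob (slow_chain w eps) i = eps ^+ w j * prob (slow_chain w eps) j.
Proof.
move=> eps_gt0 eps_le.
have x_gt0 := slow_jump_gt0 w eps_gt0.
have x_lt1 := slow_jump_lt1 w_gt0 eps_gt0 eps_le.
have exactE := sampler_exact phi_sampler (cyclic_chain_transition N_gt1 x_gt0 x_lt1)
  (cyclic_chain_irreducible x_gt0 x_lt1) (cyclic_chain_aperiodic N_gt1 x_lt1)
  (cyclic_chain_stationary N_gt1 x_gt0) (point_mass_distribution R x0).
by rewrite !exactE !mxE !mulrA !mulfV ?gt_eqF.
Qed.

Lemma slow_output_lower eps i h : 0 < eps -> eps <= 2^-1 -> contributes i h ->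
  2^-1 ^+ (m * k) * phi i h * eps ^+ output_weight i h <=
  eps ^+ w i * prob (slow_chain w eps) i.
Proof.
move=> eps_gt0 eps_le /and3P[/eqP h0 h_cyclic phi_gt0].
have /andP[lb _] := path_prob_bounds N_gt1 w_gt0 eps_gt0 eps_le h_cyclic.
rewrite /output_weight exprD mulrCA mulrA [X in X <= _]mulrC.
rewrite ler_pM2l ?exprn_gt0 // stop_output_probE (bigD1 h) //= h0 eqxx mul1r.
apply: ler_wpDr.
  apply: sumr_ge0 => h' _; have /andP[phi_ge0 _] := sampler_range phi_sampler i h'.
  by rewrite !mulr_ge0 ?path_prob_ge0.
by rewrite mulrC mulrAC ler_pM2r.
Qed.

Lemma slow_output_upper eps i E : 0 < eps -> eps <= 2^-1 ->
  (forall h, contributes i h -> (E <= output_weight i h)%N) ->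
  eps ^+ w i * prob (slow_chain w eps) i <= #|{: history N m k}|%:R * eps ^+ E.
Proof.
move=> eps_gt0 eps_le E_le; rewrite stop_output_probE mulr_sumr.
rewrite mulr_natl -sumr_const; apply: ler_sum => h _.
have eps_ge0 := ltW eps_gt0.
have [ctr|/term_noncontributing ->] := boolP (contributes i h); last first.
  by rewrite mulr0 exprn_ge0.
have /and3P[/eqP h0 h_cyclic _] := ctr.
have /andP[_ ub] := path_prob_bounds N_gt1 w_gt0 eps_gt0 eps_le h_cyclic.
have /andP[phi_ge0 phi_le1] := sampler_range phi_sampler i h.
apply: (@le_trans _ _ (eps ^+ output_weight i h)); last first.
  by rewrite ler_wiXn2l ?E_le //; lra.
rewrite h0 eqxx mul1r /output_weight addnC exprD ler_wpM2l ?exprn_ge0 //.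
by rewrite -[X in _ <= X]mulr1 ler_pM ?path_prob_ge0.
Qed.

(** If every contribution to [j] were of strictly higher order, then for small
    [eps] the balanced quantity for [j] would be smaller than the single term of
    [h] in the one for [i], although the two quantities are equal. *)
Lemma lighter_contribution i j h : contributes i h ->
  exists2 h', contributes j h' & (output_weight j h' <= output_weight i h)%N.
Proof.
move=> ctr; apply/exists_inP; apply: contraT => /exists_inPn heavier.
have /and3P[_ _ phi_gt0] := ctr.
have /andP[_ phi_le1] := sampler_range phi_sampler i h.
set C : R := #|{: history N m k}|%:R.
have C_ge1 : 1 <= C by rewrite ler1n; apply/card_gt0P; exists h.
set c : R := 2^-1 ^+ (m * k) * phi i h.
have c_gt0 : 0 < c by rewrite mulr_gt0 ?exprn_gt0 ?invr_gt0.
have c_le1 : c <= 1.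
  by rewrite mulr_ile1 ?exprn_ge0 ?exprn_ile1 ?invr_ge0 ?invf_le1 ?ler1n // ltW.
(* With [E] the order of the term of [h], this makes the upper bound
   [C * eps ^+ E.+1] half of the lower bound [c * eps ^+ E]. *)
pose eps := c / (2 * C).
have eps_gt0 : 0 < eps by rewrite divr_gt0 ?mulr_gt0 //; lra.
have eps_le : eps <= 2^-1.
  by rewrite /eps ler_pdivrMr; nra.
have low := slow_output_lower eps_gt0 eps_le ctr.
have up : eps ^+ w j * prob (slow_chain w eps) j <= C * eps ^+ (output_weight i h).+1.
  apply: slow_output_upper => // h' ctr'.
  by rewrite ltnNge; exact: heavier.
have := le_trans low (eq_ind _ (fun z => z <= _) up _ (slow_output_balance j i eps_gt0 eps_le)).
rewrite exprS mulrA ler_pM2r ?exprn_gt0 // -/c.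
have -> : C * eps = c / 2 by rewrite /eps; field; rewrite gt_eqF; lra.
lra.
Qed.

End LeadingOrder.

(** Otherwise the sampler would never stop on any lazy cyclic chain; testing one
    chain is enough, since [contributes] does not mention the transition
    matrix. *)
Lemma sampler_contributes (R : realType) (N m : nat) (phi : rules R N m)
    (x0 : config N m) : (1 < N)%N -> interruptible_exact_sampler phi ->
  exists k i (h : history N m k), contributes phi x0 i h.
Proof.
move=> N_gt1 phi_sampler.
pose w := fun _ : 'I_N => 1%N.
have w_gt0 a : (0 < w a)%N by [].
have half_gt0 : 0 < 2^-1 :> R by rewrite invr_gt0.
have x_gt0 := slow_jump_gt0 w half_gt0.
have x_lt1 := slow_jump_lt1 w_gt0 half_gt0 (lexx _).
apply: contrapT => no_contribution.
have := sampler_stops phi_sampler (cyclic_chain_transition N_gt1 x_gt0 x_lt1)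
  (cyclic_chain_irreducible x_gt0 x_lt1) (cyclic_chain_aperiodic N_gt1 x_lt1)
  (point_mass_distribution R x0).
set u := fun k : nat => _.
have -> : u = fun=> 0.
  apply/funext => k; rewrite /u big1 // => i _.
  rewrite stop_output_probE big1 // => h _.
  apply: (term_noncontributing w phi_sampler); apply/negP => ctr.
  by apply: no_contribution; exists k, i, h.
by rewrite lim_cst ?ltxx //; exact: norm_hausdorff.
Qed.

Theorem theorem5p1 (R : realType) (N m : nat) (hN : (2 <= N)%N) (hm : (m < N)%N) :
  ~ exists phi : rules R N m, interruptible_exact_sampler phi.
Proof.
case=> phi phi_sampler.
pose x0 : config N m := [ffun=> Ordinal (ltnW hN)].
have [k [i0 [h0 ctr0]]] := sampler_contributes x0 hN phi_sampler.
(* Jump counts are at most [m * k], and the stationary weight adds at most 1. *)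
pose b := (m * k).+2.
pose w (v : 'I_N) := (b ^ v)%N.
have w_gt0 v : (0 < w v)%N by rewrite expn_gt0.
pose ctr (p : 'I_N * history N m k) := contributes phi x0 p.1 p.2.
have [[i h] /= ctr_h min_h] :=
  @arg_minnP _ (i0, h0) ctr (fun p => output_weight w p.1 p.2) ctr0.
pose digit j (g : history N m k) v := (jump_count g v + (v == j))%N.
have output_weightE j g : output_weight w j g = (\sum_v digit j g v * w v)%N.
  rewrite /output_weight /path_weight; under [RHS]eq_bigr do rewrite mulnDl.
  rewrite big_split; congr (_ + _)%N; rewrite (bigD1 j) //= eqxx mul1n big1 ?addn0 //.
  by move=> v /negbTE ->.
have digit_lt j g v : (digit j g v < b)%N.
  by have := jump_count_le g v; have := leq_b1 (v == j); rewrite /digit /b; lia.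
(* [digit i h] is the common exponent vector, read here off a history [g] for
   output [j]: the stationary weight adds 1 at [j] and 0 at [ordS j]. *)
have step j : (digit i h (ordS j) + 1 <= digit i h j + start_count h (ordS j))%N.
  have [g ctr_g le_gh] := lighter_contribution hN w_gt0 phi_sampler j ctr_h.
  have digit_eq : digit i h =1 digit j g.
    apply: (@digits_inj _ b) => //; rewrite -!output_weightE; apply/eqP.
    by rewrite eqn_leq le_gh (min_h (j, g)).
  have /and3P[/eqP g0 g_cyclic _] := ctr_g; have /and3P[/eqP h0E _ _] := ctr_h.
  have := jump_count_flow j g_cyclic.
  rewrite !digit_eq /digit eqxx (negbTE (ordS_neq j hN)) addn0.
  rewrite /start_count g0 h0E; lia.
have : (\sum_j (digit i h (ordS j) + 1) <=
    \sum_j (digit i h j + start_count h (ordS j)))%N by exact: leq_sum.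
rewrite [X in (X <= _)%N]big_split [X in (_ <= X)%N]big_split /= sum1_card card_ord.
have reindexS (f : 'I_N -> nat) : (\sum_j f (ordS j) = \sum_j f j)%N.
  by rewrite [RHS](reindex (@ordS N)) //; apply/onW_bij/ordS_bij.
by rewrite (reindexS (digit i h)) reindexS sum_start_count leq_add2l leqNgt hm.
Qed.
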